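(* There exists a proper geodesic metric space $X$ with $|\mathcal{E}\mathrm{nds}(X)|<|\pi_0^{\mathrm{Crs}}(X)|$.
   Context: A metric space is proper if its closed bounded subsets are exactly its compact subsets, and geodesic if any two points $x,x'$ are joined by an isometric embedding of $[0,d_X(x,x')]$ starting at $x$ and ending at $x'$. Ends: for proper $X$, two continuous maps $r,r':\mathbb{R}_{\ge0}\to X$ that are metrically proper (preimages of bounded sets are bounded) are equivalent if for every bounded $B\subseteq X$ there is $t\ge0$ such that $r([t,\infty))$ and $r'([t,\infty))$ lie in the same path component of $X\setminus B$. $\mathcal{E}\mathrm{nds}(X)$ is the set of equivalence classes. Coarse path components: a map $f:X\to Y$ of metric spaces is controlled if for every $R>0$ there is $S>0$ such that $d_X(x,x')<R$ implies $d_Y(f(x),f(x'))<S$; proper if preimages of bounded sets are bounded; coarse if both. For a coarse map $q:X\to\mathbb{R}_{\ge0}$, let $I_qX=\{(x,t)\in X\times\mathbb{R}_{\ge0}:t\le q(x)\}$ with the restriction of the max product metric. Coarse maps $f,g:X\to Y$ are coarse homotopic if there are coarse maps $q:X\to\mathbb{R}_{\ge0}$ and $H:I_qX\to Y$ with $H(x,0)=f(x)$, $H(x,q(x))=g(x)$ for all $x$; this is an equivalence relation. $\pi_0^{\mathrm{Crs}}(X)$ is the set of coarse homotopy classes of coarse maps $\mathbb{R}_{\ge0}\to X$. *)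

(* Defs.v *)
From HB Require Import structures.
From mathcomp Require Import all_boot all_order all_algebra.
From mathcomp Require Import all_classical all_reals all_analysis.

Set Implicit Arguments.
Unset Strict Implicit.
Unset Printing Implicit Defensive.

Import Order.TTheory GRing.Theory Num.Theory.
Import numFieldNormedType.Exports.

Local Open Scope classical_set_scope.
Local Open Scope ring_scope.
Local Open Scope card_scope.

(* The library only equips [X * Y] and [set_type A] with pseudometrics; the two
   instances below enrich these same structures (max metric, restricted metric)
   to metric spaces. *)
Section prod_metric.
Context {R : realType} {X Y : metricType R}.

Definition prod_mdist (p p' : X * Y) : R :=
  Num.max (mdist p.1 p'.1) (mdist p.2 p'.2).

Let prod_mdist_ge0 p p' : 0 <= prod_mdist p p'.
Proof. by rewrite le_max mdist_ge0. Qed.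

Let prod_mdist_positivity p p' : prod_mdist p p' = 0 -> p = p'.
Proof.
case: p p' => [x y] [x' y'] /= d0.
have : prod_mdist (x, y) (x', y') <= 0 by rewrite d0.
rewrite ge_max /= => /andP[dx dy].
congr pair; apply: (@mdist_positivity R); apply/eqP.
  by rewrite eq_le dx mdist_ge0.
by rewrite eq_le dy mdist_ge0.
Qed.

Let ball_prod_mdist p d : ball p d = [set p' | prod_mdist p p' < d].
Proof.
apply/seteqP; split => p' /=; rewrite /ball/= /prod_ball !ballEmdist /=.
  by case=> dx dy; rewrite gt_max dx dy.
by rewrite gt_max => /andP[].
Qed.

HB.instance Definition _ := PseudoMetric_isMetric.Build R (X * Y)%type
  prod_mdist_ge0 prod_mdist_positivity ball_prod_mdist.

Lemma mdist_prodE (p p' : X * Y) :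
  mdist p p' = Num.max (mdist p.1 p'.1) (mdist p.2 p'.2).
Proof. by []. Qed.

End prod_metric.

Section subtype_metric.
Context {R : realType} {X : metricType R} (A : set X).

Definition sub_mdist (x y : A) : R := mdist (\val x) (\val y).

Let sub_mdist_ge0 x y : 0 <= sub_mdist x y.
Proof. exact: mdist_ge0. Qed.

Let sub_mdist_positivity x y : sub_mdist x y = 0 -> x = y.
Proof. by move=> /mdist_positivity /val_inj. Qed.

Let ball_sub_mdist x d : ball x d = [set y | sub_mdist x y < d].
Proof.
by rewrite -initial_ballE ballEmdist; apply/seteqP; split => y; rewrite /= set_valE.
Qed.

HB.instance Definition _ := PseudoMetric_isMetric.Build R (A : Type)
  sub_mdist_ge0 sub_mdist_positivity ball_sub_mdist.

Lemma mdist_subE (x y : A) : mdist x y = mdist (\val x) (\val y).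
Proof. by []. Qed.

End subtype_metric.

(* Over [R^o], the copy of R carrying the library's metric [`|y - x|]. *)
Definition half_line (R : realType) : set R^o := [set t | 0 <= t].
Arguments half_line : clear implicits.

Section metric_notions.
Context {R : realType}.

Definition mbounded {X : metricType R} (B : set X) :=
  exists r : R, forall x y, B x -> B y -> mdist x y <= r.

Definition proper_space (X : metricType R) :=
  forall A : set X, closed A /\ mbounded A <-> compact A.

(* Only the values of [g] on [0, mdist x x'] matter. *)
Definition geodesic_space (X : metricType R) :=
  forall x x' : X, exists g : R -> X,
    [/\ g 0 = x, g (mdist x x') = x' &
        forall s t, 0 <= s <= mdist x x' -> 0 <= t <= mdist x x' ->
          mdist (g s) (g t) = `|s - t|].

Definition controlled_map {X Y : metricType R} (f : X -> Y) :=
  forall r : R, 0 < r -> exists2 s : R, 0 < s &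
    forall x x', mdist x x' < r -> mdist (f x) (f x') < s.

Definition proper_map {X Y : metricType R} (f : X -> Y) :=
  forall B : set Y, mbounded B -> mbounded (f @^-1` B).

Definition coarse_map {X Y : metricType R} (f : X -> Y) :=
  controlled_map f /\ proper_map f.

End metric_notions.
Arguments proper_space {R} X.
Arguments geodesic_space {R} X.

Section ends.
Context {R : realType} (X : metricType R).

Definition path_component (A : set X) (x : X) : set X :=
  [set y | exists g : R -> X,
    [/\ {within `[0, 1], continuous g}, g 0 = x, g 1 = y &
        g @` `[0, 1] `<=` A]].

Definition path_components (A : set X) : set (set X) :=
  [set path_component A x | x in A].

Definition proper_ray : set (half_line R -> X) :=
  [set r | continuous r /\ proper_map r].

Definition ray_tail (r : half_line R -> X) (t : half_line R) : set X :=
  [set r s | s in [set s | \val t <= \val s]].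

Definition ray_equiv (r r' : half_line R -> X) :=
  forall B : set X, mbounded B -> exists t : half_line R,
    exists2 C, path_components (~` B) C &
      ray_tail r t `<=` C /\ ray_tail r' t `<=` C.

Definition Ends : set (set (half_line R -> X)) :=
  [set proper_ray `&` ray_equiv r | r in proper_ray].

End ends.
Arguments proper_ray {R} X.
Arguments Ends {R} X.

Section coarse_homotopy.
Context {R : realType}.

Definition coarse_cylinder {X : metricType R} (q : X -> half_line R) :
    set (X * half_line R) :=
  [set p | \val p.2 <= \val (q p.1)].

Definition coarse_homotopic {X Y : metricType R} (f g : X -> Y) :=
  exists (q : X -> half_line R) (H : coarse_cylinder q -> Y),
    [/\ coarse_map q, coarse_map H,
        forall p, \val (\val p).2 = 0 -> H p = f (\val p).1 &
        forall p, (\val p).2 = q (\val p).1 -> H p = g (\val p).1].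

Definition coarse_pi0 (X : metricType R) : set (set (half_line R -> X)) :=
  [set coarse_map `&` coarse_homotopic f | f in coarse_map].

End coarse_homotopy.
Arguments coarse_pi0 {R} X.

Definition card_lt T U (A : set T) (B : set U) := (A #<= B) && ~~ (B #<= A).

(* Main.v *)
(** The space is a necklace of circles of unbounded lengths: two copies of the
    half-line glued at the squares n^2.  What lies beyond a node is path
    connected, so there is at most one end.  The two copies of the half-line are
    coarse rays f and g.  A coarse homotopy from f to g yields a grid of points
    of the necklace whose neighbours are at distance < S.  Count the signed
    crossings of a point m of the first copy that is far from all nodes: around
    each small square of the grid the count is zero, hence so is the count
    along the boundary of the grid.  If m is far enough, the path at parameter 0
    stays before m, and by properness the path at a large parameter stays beyond
    m; but f crosses m once while g never does, a contradiction. *)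

From HB Require Import structures.
Require Import Defs.
From mathcomp Require Import all_boot all_order all_algebra.
From mathcomp Require Import all_classical all_reals all_analysis.
From mathcomp Require Import lra zify.

Set Implicit Arguments.
Unset Strict Implicit.
Unset Printing Implicit Defensive.

Import Order.TTheory GRing.Theory Num.Theory.
Import numFieldNormedType.Exports.

Local Open Scope classical_set_scope.
Local Open Scope ring_scope.
Local Open Scope card_scope.

(** * Squares as nodes, and the cost of passing through one *)

Section nodes.
Context {R : realType}.
Implicit Types x y z : R.

Definition node : set R := range (fun n : nat => (n ^ 2)%:R).

Lemma node0 : node 0.
Proof. by exists 0%N. Qed.

Lemma node_unbounded x : exists2 z, node z & x < z.
Proof.
exists ((Num.trunc x).+1 ^ 2)%:R; first by exists (Num.trunc x).+1.
by rewrite (lt_le_trans (truncnS_gt x))// ler_nat; exact: leq_pmulr.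
Qed.

(** The witness [k ^ 2 + k] lies [k] past one square and [k + 1] before the next. *)
Lemma node_gap x : exists2 m, x <= m & forall z, node z -> x <= `|z - m|.
Proof.
have [k xk] : exists k : nat, x <= k%:R.
  by exists (Num.trunc x).+1; exact/ltW/truncnS_gt.
exists (k ^ 2 + k)%:R.
  by rewrite (le_trans xk)// ler_nat leq_addl.
move=> _ [n _ <-]; rewrite (le_trans xk)//.
have [nk|kn] := leqP n k.
  rewrite distrC ger0_norm ?subr_ge0 ?ler_nat.
    by rewrite -natrB ?ler_nat -!mulnn; nia.
  by rewrite -!mulnn; nia.
rewrite ger0_norm ?subr_ge0 ?ler_nat.
  by rewrite -natrB ?ler_nat -!mulnn; nia.
by rewrite -!mulnn; nia.
Qed.

(* The distance of [x] and [y] when they lie in different copies. *)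
Definition detour x y : R := inf [set `|x - z| + `|z - y| | z in node].

Lemma detourP x y : exists2 z, node z & detour x y = `|x - z| + `|z - y|.
Proof.
pose F (n : nat) : R := `|x - (n ^ 2)%:R| + `|(n ^ 2)%:R - y|.
(* For [n > N] the first leg of [F n] alone costs at least [F 0], so finitely many nodes compete for
   the infimum. *)
pose N := (Num.trunc (`|x| + `|x| + `|y|)).+1.
have [/= i _ iP] := @arg_minP _ _ 'I_N.+1 ord0 xpredT (fun i => F i) isT.
have Fi n : F i <= F n.
  have [nN|Nn] := ltnP n N.+1; first exact: (iP (Ordinal nN)).
  apply: le_trans (iP ord0 isT) _; rewrite /F /= subr0 sub0r normrN.
  have : `|x| + `|x| + `|y| <= (n ^ 2)%:R.
    rewrite (le_trans (ltW (truncnS_gt _)))// ler_nat.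
    by rewrite (leq_trans (ltnW Nn))// -mulnn; nia.
  have := ler_norm x; have := ler_norm (y - (n ^ 2)%:R).
  have := ler_norm ((n ^ 2)%:R - x); have := normr_ge0 ((n ^ 2)%:R - y).
  rewrite (distrC x (n ^ 2)%:R); lra.
exists (i ^ 2)%:R; first by exists (val i).
apply/eqP; rewrite eq_le; apply/andP; split.
  apply: ge_inf; last by exists (i ^ 2)%:R => //; exists (val i).
  by exists 0 => _ [z _ <-]; rewrite addr_ge0.
apply: lb_le_inf.
  by exists (`|x - 0| + `|0 - y|); exists 0 => //; exact: node0.
by move=> _ [_ [n _ <-] <-]; exact: Fi.
Qed.

Lemma detour_le x y z : node z -> detour x y <= `|x - z| + `|z - y|.
Proof.
move=> nz; apply: ge_inf; last by exists z.
by exists 0 => _ [z' _ <-]; rewrite addr_ge0.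
Qed.

Lemma detourC x y : detour x y = detour y x.
Proof.
by congr inf; apply: eq_imagel => z _; rewrite addrC (distrC z y) (distrC x z).
Qed.

Lemma dist_le_detour x y : `|x - y| <= detour x y.
Proof. by have [z _ ->] := detourP x y; exact: ler_distD. Qed.

Lemma detour_node z x : node z -> detour z x = `|z - x|.
Proof.
move=> nz; apply/eqP; rewrite eq_le dist_le_detour andbT.
by rewrite (le_trans (detour_le _ _ nz))// subrr normr0 add0r.
Qed.

Lemma detour_eq0 x y : detour x y = 0 -> node x /\ x = y.
Proof.
have [z nz ->] := detourP x y => /eqP.
by rewrite paddr_eq0// !normr_eq0 !subr_eq0 => /andP[/eqP-> /eqP<-].
Qed.

Lemma detour_triangle y x z : detour x z <= `|x - y| + detour y z.
Proof.
have [t nt ->] := detourP y z; apply: le_trans (detour_le _ _ nt) _.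
by rewrite addrA lerD2r ler_distD.
Qed.

End nodes.
Arguments node : clear implicits.

(** * The necklace and its metric *)

Section necklace.
Context (R : realType).
Implicit Types (x y : R) (b : bool).

(* A node belongs to both copies and is represented by its [true] copy. *)
Definition in_necklace : pred (R * bool) :=
  fun p => (0 <= p.1) && (p.2 || (p.1 \notin node R)).

Definition necklace : Type := {p : R * bool | in_necklace p}.
HB.instance Definition _ := Choice.on necklace.

Definition npos (p : necklace) : R := (sval p).1.
Definition nside (p : necklace) : bool := (sval p).2.

Lemma npos_ge0 p : 0 <= npos p.
Proof. by have /andP[] := svalP p. Qed.

Lemma nside_node p : node R (npos p) -> nside p.
Proof.
move=> np; have /andP[_ /orP[//|/negP[]]] := svalP p.
exact/mem_set.
Qed.

Lemma necklace_inj p q : npos p = npos q -> nside p = nside q -> p = q.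
Proof.
move=> pq bpq; apply: val_inj => /=.
by rewrite [val p]surjective_pairing [val q]surjective_pairing; congr pair.
Qed.

(** A node has side [true], so against a [false] point it falls under the second branch, where
    [detour] is the direct distance by [detour_node]. *)
Definition ndist (p q : necklace) : R :=
  if nside p == nside q then `|npos p - npos q| else detour (npos p) (npos q).

Lemma npos_ndist p q : `|npos p - npos q| <= ndist p q.
Proof. by rewrite /ndist; case: ifP => // _; exact: dist_le_detour. Qed.

Let ndistxx p : ndist p p = 0.
Proof. by rewrite /ndist eqxx subrr normr0. Qed.

Let ndist_positivity p q : ndist p q = 0 -> p = q.
Proof.
rewrite /ndist; case: eqP => [bpq|bpq].
  by move=> /normr0_eq0/subr0_eq pq; exact: necklace_inj.
move=> /detour_eq0[np pq]; exfalso; apply: bpq.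
by rewrite !nside_node// -pq.
Qed.

Let ndist_sym p q : ndist p q = ndist q p.
Proof. by rewrite /ndist eq_sym distrC detourC. Qed.

Let ndist_triangle q p r : ndist p r <= ndist p q + ndist q r.
Proof.
have [bpr|bpr] := boolP (nside p == nside r).
  rewrite {1}/ndist bpr (le_trans (ler_distD (npos q) _ _))//.
  by rewrite lerD// npos_ndist.
rewrite {1}/ndist (negbTE bpr).
have [bpq|bpq] := boolP (nside p == nside q).
  rewrite (le_trans (detour_triangle (npos q) _ _))//.
  by rewrite /ndist bpq -(eqP bpq) (negbTE bpr).
have bqr : nside q == nside r.
  by move: bpr bpq; case: (nside p); case: (nside q); case: (nside r).
rewrite detourC (le_trans (detour_triangle (npos q) _ _))//.
by rewrite addrC detourC distrC /ndist (negbTE bpq) bqr.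
Qed.

HB.instance Definition _ := isMetric.Build R necklace
  ndistxx ndist_positivity ndist_sym ndist_triangle.

Lemma mdist_necklaceE (p q : necklace) : mdist p q = ndist p q.
Proof. by []. Qed.

Let bead_subproof x b :
  in_necklace (`|x|, b || (`|x| \in node R)).
Proof. by rewrite /in_necklace/= normr_ge0 -orbA orbN orbT. Qed.

(* The absolute value only makes [bead] total. *)
Definition bead b x : necklace :=
  exist (fun p => in_necklace p) _ (bead_subproof x b).

Lemma npos_bead b x : npos (bead b x) = `|x|.
Proof. by []. Qed.

Lemma nside_bead b x : nside (bead b x) = b || (`|x| \in node R).
Proof. by []. Qed.

Lemma bead_nside p : bead (nside p) (npos p) = p.
Proof.
apply: necklace_inj; first by rewrite npos_bead ger0_norm// npos_ge0.
rewrite nside_bead ger0_norm ?npos_ge0//.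
apply/orb_idr => /set_mem; exact: nside_node.
Qed.

Lemma bead_node b x : node R x -> bead b x = bead true x.
Proof.
move=> nx; have x0 : 0 <= x by case: nx => n _ <-.
apply: necklace_inj => //; rewrite !nside_bead ger0_norm//=.
by apply/orP; right; exact/mem_set.
Qed.

(** Beads with the same label get different sides only if one of them is a node, and then the detour
    is direct. *)
Lemma mdist_bead_le b x y : mdist (bead b x) (bead b y) <= `|x - y|.
Proof.
apply: le_trans (ler_dist_dist x y).
rewrite mdist_necklaceE /ndist !nside_bead !npos_bead.
case: b => //=; case: ifPn => //.
have [xn|xn] := boolP (`|x| \in node R) => /=.
  by rewrite detour_node//; exact: set_mem.
have [yn _|//] := boolP (`|y| \in node R).
by rewrite detourC distrC detour_node//; exact: set_mem.
Qed.

End necklace.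

(** * Bounded subsets of the half-line and constant coarse homotopies *)

Section half_line_maps.
Context (R : realType).

Let half_line_proof (x : R) : `|x| \in half_line R.
Proof. by apply/mem_set; rewrite /half_line/=. Qed.

(* The absolute value only makes [half] total. *)
Definition half (x : R) : half_line R := SigSub (half_line_proof x).

Lemma half_line_ge0 (t : half_line R) : 0 <= \val t :> R.
Proof. exact: set_mem (valP t). Qed.

Lemma mdist_halfE (t t' : half_line R) : mdist t t' = `|\val t' - \val t| :> R.
Proof. by []. Qed.

Lemma half_line_mbounded (A : set (half_line R)) (M : R) :
  (forall t, A t -> \val t <= M) -> mbounded A.
Proof.
move=> AM; exists M => t t' /AM tM /AM t'M; rewrite mdist_halfE.
have := half_line_ge0 t; have := half_line_ge0 t'.
by rewrite ler_norml => ? ?; apply/andP; split; lra.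
Qed.

Lemma mbounded_half_line (A : set (half_line R)) : mbounded A ->
  exists t0 : half_line R, forall t, A t -> \val t <= \val t0.
Proof.
move=> [r Ar].
have [->|/set0P[u Au]] := eqVneq A set0.
  by exists (half 0) => t.
have u0 : 0 <= \val u by exact: half_line_ge0.
have ur0 : half_line R (\val u + `|r|) by rewrite /half_line/= addr_ge0.
exists (SigSub (mem_set ur0)) => t At /=.
have := Ar _ _ Au At; have := ler_norm r.
have := ler_norm (\val t - \val u); rewrite mdist_subE /mdist/=; lra.
Qed.

(** The homotopy is constant over [q = id]: heights are then at most the first coordinate, which
    makes the projection to that coordinate proper. *)
Lemma coarse_homotopic_refl (X : metricType R) (f : half_line R -> X) :
  coarse_map f -> coarse_homotopic f f.
Proof.
move=> [cf pf]; exists id, (fun p => f (\val p).1); split=> //.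
  by split=> // r r0; exists r.
split=> [r /cf[s s0 fs]|B /pf/mbounded_half_line[t0 ft0]].
  exists s => // p p'; rewrite mdist_subE mdist_prodE gt_max => /andP[pp' _].
  exact: fs.
exists (\val t0) => p p' /ft0/= pt /ft0/= p't.
have pq := set_mem (valP p); have p'q := set_mem (valP p').
rewrite /coarse_cylinder/= in pq p'q.
rewrite mdist_subE mdist_prodE !mdist_halfE ge_max !ler_norml.
have := half_line_ge0 (\val p).1; have := half_line_ge0 (\val p).2.
have := half_line_ge0 (\val p').1; have := half_line_ge0 (\val p').2.
by move=> /= ? ? ? ?; apply/andP; split; apply/andP; split; lra.
Qed.

End half_line_maps.

Lemma lipschitz_continuous (R : realType) (X Y : metricType R) (f : X -> Y) :
  (forall x y, mdist (f x) (f y) <= mdist x y) -> continuous f.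
Proof.
move=> lipf x; apply/cvg_ballP => e e0.
apply: filterS (nbhsx_ballx x e e0) => y.
by rewrite !ballEmdist; exact: le_lt_trans.
Qed.

(** * The necklace is proper, geodesic and has at most one end *)

Section necklace_geometry.
Context (R : realType).
Local Notation X := (necklace R).
Implicit Types (p q : X) (b : bool).

Lemma bead_continuous b : continuous (@bead R b : R -> X).
Proof.
apply: (@lipschitz_continuous _ R^o) => x y.
by rewrite (le_trans (mdist_bead_le _ _ _))// distrC.
Qed.

Lemma npos_continuous : continuous (@npos R : X -> R).
Proof.
apply: (@lipschitz_continuous _ _ R^o) => p q.
by rewrite [leLHS]distrC npos_ndist.
Qed.

Lemma mdist_le_npos p q : mdist p q <= npos p + npos q.
Proof.
have [p0 q0] := (npos_ge0 p, npos_ge0 q).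
rewrite mdist_necklaceE /ndist; case: ifP => _.
  by rewrite ler_norml; apply/andP; split; lra.
apply: le_trans (detour_le _ _ node0) _.
by rewrite subr0 sub0r normrN !ger0_norm.
Qed.

Lemma mbounded_necklaceP (B : set X) :
  mbounded B <-> exists M, forall p, B p -> npos p <= M.
Proof.
split=> [[r Br]|[M BM]]; last first.
  exists (M + M) => p q /BM pM /BM qM.
  by rewrite (le_trans (mdist_le_npos _ _))// lerD.
have [->|/set0P[q Bq]] := eqVneq B set0; first by exists 0 => p.
exists (npos q + r) => p Bp; have := npos_ndist p q; have := Br _ _ Bp Bq.
have := ler_norm (npos p - npos q); rewrite mdist_necklaceE; lra.
Qed.

Lemma necklace_proper : proper_space X.
Proof.
move=> A; split=> [[clA /mbounded_necklaceP[M AM]]|cA].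
  pose K b := bead b @` (`[0, M] `&` bead b @^-1` A).
  have cK b : compact (K b).
    apply: continuous_compact.
      by apply: continuous_subspaceT; exact: bead_continuous.
    apply: compact_closedI; first exact: segment_compact.
    by apply: preimage_closed => // x _; exact: bead_continuous.
  suff -> : A = K true `|` K false by apply: compactU.
  apply/seteqP; split=> [p Ap|p [] [x [_ Ax] <-//]].
  have Kp : K (nside p) p.
    exists (npos p); last exact: bead_nside.
    by split; [rewrite /= in_itv/= npos_ge0 AM|rewrite /preimage/= bead_nside].
  by move: Kp; case: (nside p); [left|right].
split; first by apply: compact_closed => //; exact: metric_hausdorff.
apply/mbounded_necklaceP.
have /compact_bounded[M [_ AM]] : compact ((@npos R : X -> R^o) @` A).
  apply: continuous_compact => //.
  exact/continuous_subspaceT/npos_continuous.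
exists (M + 1) => p Ap; rewrite (le_trans (ler_norm _))//.
by apply: (AM (M + 1)); [rewrite ltrDl|exists p].
Qed.

(** By the triangle inequality, a loss of length on [[s, t]] would bring the two ends closer than
    [L]. *)
Lemma lipschitz_geodesic (Y : metricType R) (g : R -> Y) (L : R) :
  (forall s t, mdist (g s) (g t) <= `|s - t|) -> mdist (g 0) (g L) = L ->
  forall s t, 0 <= s <= L -> 0 <= t <= L -> mdist (g s) (g t) = `|s - t|.
Proof.
move=> lipg gL s t /andP[s0 sL] /andP[t0 tL].
wlog st : s t s0 sL t0 tL / s <= t => [th|].
  by have [|/ltW] := leP t s => st; [rewrite metric_sym distrC|]; exact: th.
apply/eqP; rewrite eq_le lipg/=.
have := metric_triangle (g 0) (g s) (g L).
have := metric_triangle (g s) (g t) (g L).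
have := lipg 0 s; have := lipg t L.
rewrite gL sub0r normrN (ger0_norm s0).
rewrite !ler0_norm ?subr_le0//; lra.
Qed.

(** Treats both cases of the distance alike, as two straight legs meeting at [z]: an optimal node if
    the sides differ, and [npos q], with an empty second leg, if they agree. *)
Lemma via_point p q : exists2 z : R, bead (nside p) z = bead (nside q) z &
  mdist p q = `|npos p - z| + `|z - npos q|.
Proof.
rewrite mdist_necklaceE /ndist; case: eqP => [->|_].
  by exists (npos q); rewrite // subrr normr0 addr0.
have [z nz ->] := detourP (npos p) (npos q).
by exists z; rewrite // !(bead_node _ nz).
Qed.

Definition walk (x y s : R) := x + Num.sg (y - x) * s.

Lemma walk_dist x y s t : `|walk x y s - walk x y t| <= `|s - t|.
Proof.
rewrite /walk opprD addrACA subrr add0r -mulrBr normrM normr_sg.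
by case: (_ != 0); rewrite ?mul1r// mul0r.
Qed.

Lemma walk0 x y : walk x y 0 = x.
Proof. by rewrite /walk mulr0 addr0. Qed.

Lemma walk_end x y : walk x y `|x - y| = y.
Proof. by rewrite /walk distrC -numEsg addrC subrK. Qed.

Lemma necklace_geodesic : geodesic_space X.
Proof.
move=> p q; have [z zpq pqE] := via_point p q.
pose c := `|npos p - z|.
pose g s : X := if s <= c then bead (nside p) (walk (npos p) z s)
  else bead (nside q) (walk z (npos q) (s - c)).
have gp : g 0 = p by rewrite /g normr_ge0 walk0 bead_nside.
have gq : g (mdist p q) = q.
  (* If [z = npos q], the final time still falls in the first branch of [g]. *)
  rewrite /g pqE gerDl normr_le0 subr_eq0; case: eqP => [zq|_].
    rewrite zq subrr normr0 addr0 -zq /c walk_end zpq zq.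
    exact: bead_nside.
  by rewrite addrC addKr walk_end bead_nside.
have lipg s t : mdist (g s) (g t) <= `|s - t|.
  wlog st : s t / s <= t => [th|].
    by have [|/ltW] := leP t s => st; [rewrite metric_sym distrC|]; exact: th.
  rewrite /g; have [sc|sc] := leP s c; have [tc|tc] := leP t c.
  - exact: le_trans (mdist_bead_le _ _ _) (walk_dist _ _ _ _).
  (* Here [s <= c < t]: the triangle inequality goes through the corner at [z], which both legs
     share. *)
  - have := mdist_bead_le (nside p) (walk (npos p) z s) (walk (npos p) z c).
    have := mdist_bead_le (nside q) (walk z (npos q) 0)
      (walk z (npos q) (t - c)).
    have := walk_dist (npos p) z s c; have := walk_dist z (npos q) 0 (t - c).
    have := metric_triangle (bead (nside p) (walk (npos p) z s))
      (bead (nside p) z) (bead (nside q) (walk z (npos q) (t - c))).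
    rewrite walk_end walk0 -zpq sub0r normrN.
    rewrite (@gtr0_norm _ (t - c)) ?subr_gt0//.
    rewrite (@ler0_norm _ (s - c)) ?subr_le0//.
    by rewrite (@ler0_norm _ (s - t)) ?subr_le0//; lra.
  - by lra.
  - apply: le_trans (mdist_bead_le _ _ _) (le_trans (walk_dist _ _ _ _) _).
    by rewrite opprB addrA subrK.
exists g; split=> //.
by apply: lipschitz_geodesic => //; rewrite gp gq.
Qed.

(** The two copies meet at the node [z], and the straight segment from it to [p] stays at positions
    at least [z]. *)
Lemma bead_path_component (B : set X) z p : node R z -> z <= npos p ->
  (forall q, B q -> npos q < z) -> path_component (~` B) (bead true z) p.
Proof.
move=> nz zp Bz; have z0 : 0 <= z by case: nz => n _ <-.
exists (fun s => bead (nside p) (z + s * (npos p - z))); split.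
- apply: continuous_subspaceT => s.
  have cw : {for s, continuous (fun s : R => z + s * (npos p - z))}.
    by apply: cvgD; [exact: cvg_cst|apply: cvgMr_tmp; exact: cvg_id].
  exact: (continuous_comp cw (@bead_continuous _ _)).
- by rewrite mul0r addr0 bead_node.
- by rewrite mul1r addrC subrK bead_nside.
- move=> _ [s /= /[!in_itv]/= /andP[s0 s1] <-] /Bz.
  have sz : 0 <= s * (npos p - z) by rewrite mulr_ge0// subr_ge0.
  by rewrite npos_bead ger0_norm; lra.
Qed.

Lemma ray_equiv_necklace (r r' : half_line R -> X) :
  proper_map r -> proper_map r' -> ray_equiv r r'.
Proof.
move=> pr pr' B /mbounded_necklaceP[M BM].
have [z nz Mz] := node_unbounded M.
have z0 : 0 <= z by case: nz => n _ <-.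
have bz : mbounded [set p : X | npos p <= z].
  by apply/mbounded_necklaceP; exists z.
have [t rt] := mbounded_half_line (pr _ bz).
have [t' r't'] := mbounded_half_line (pr' _ bz).
have tt0 : half_line R (\val t + \val t' + 1).
  have : 0 <= \val t by exact: half_line_ge0.
  have : 0 <= \val t' by exact: half_line_ge0.
  by rewrite /half_line/=; lra.
have Bz q : B q -> npos q < z by move=> /BM; lra.
exists (SigSub (mem_set tt0)); exists (path_component (~` B) (bead true z)).
  exists (bead true z) => //= /Bz; rewrite npos_bead ger0_norm//; lra.
have /= t0 : 0 <= \val t by exact: half_line_ge0.
have /= t'0 : 0 <= \val t' by exact: half_line_ge0.
split=> _ [s /= ts <-]; apply: bead_path_component => //; rewrite leNgt;
  apply/negP => /ltW.
- by move/rt => /=; lra.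
- by move/r't' => /=; lra.
Qed.

Lemma Ends_necklace : Ends X `<=` [set proper_ray X].
Proof.
move=> _ [r [_ pr] <-]; apply/seteqP; split=> [r' []//|r' [cr' pr']].
by split=> //; exact: ray_equiv_necklace.
Qed.

End necklace_geometry.

(** A discrete Stokes formula: the outer induction adds a column of squares, the inner one stacks
    the squares of that column. *)
Lemma grid_boundary (V : zmodType) (v h : nat -> nat -> V) :
  (forall i j, v i j + h i j.+1 = h i j + v i.+1 j) ->
  forall m n, \sum_(j < n) v 0%N j + \sum_(i < m) h i n =
              \sum_(i < m) h i 0%N + \sum_(j < n) v m j.
Proof.
move=> sq m n; elim: m => [|m IHm]; first by rewrite !big_ord0 addr0 add0r.
rewrite !big_ord_recr/= addrA IHm -!addrA; congr (_ + _).
elim: n {IHm} => [|n IHn]; first by rewrite !big_ord0 add0r addr0.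
by rewrite !big_ord_recr/= -addrA sq !addrA IHn.
Qed.

(** * Signed crossings of [m], and the two coarse rays *)

Section necklace_rays.
Context (R : realType).
Local Notation X := (necklace R).
Implicit Types (p : X) (b : bool).

Definition ray b (t : half_line R) : X := bead b (\val t).

Lemma ray_coarse b : coarse_map (ray b).
Proof.
split=> [r r0|B /mbounded_necklaceP[M BM]].
  exists r => // t t'; rewrite mdist_halfE distrC; apply: le_lt_trans.
  exact: mdist_bead_le.
apply: (@half_line_mbounded _ _ M) => t /BM.
by rewrite npos_bead ger0_norm// half_line_ge0.
Qed.

(** Being a difference of indicators, it telescopes along points of the [true] copy. *)
Definition crossing (m : R) p p' : R :=
  if nside p && nside p' then (m <= npos p')%R%:R - (m <= npos p)%R%:R else 0.

Section square.
Variables (m S : R).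
Hypothesis mS : forall z, node R z -> 3 * S <= `|z - m|.

(** If [p] and [p'] are on the [true] copy, the way from [r] to [p] passes a node [z]. So [p] is
    within [2 * S] and [p'] within [3 * S] of [z], and [m] is too far from [z] to separate them. *)
Lemma crossing_eq0 r p p' : ~~ nside r -> mdist r p < S + S ->
  mdist p p' < S -> crossing m p p' = 0.
Proof.
move=> nr rp pp'; rewrite /crossing; case: ifP => // /andP[np np'].
move: rp; rewrite mdist_necklaceE /ndist (negbTE nr) np/=.
have [z nz ->] := detourP (npos r) (npos p) => rzp.
have := le_lt_trans (npos_ndist p p') pp'.
have := mS nz; have := normr_ge0 (npos r - z).
have := ler_norm (z - npos p); have := ler_norm (npos p - z).
rewrite (distrC (npos p) z) => ? ? ? zm.
rewrite ltr_norml => /andP[? ?].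
have [mp|pm] := leP m (npos p); have [mp'|p'm] := leP m (npos p');
  rewrite ?subrr//; exfalso; move: zm; apply/negP; rewrite -ltNge ltr_norml;
  by apply/andP; split; lra.
Qed.

(** If a corner is off the [true] copy, every edge counts zero by [crossing_eq0], as all corners are
    within [2 * S] of it. Otherwise both sums telescope to the same difference. *)
Lemma crossing_square p00 p10 p01 p11 :
  mdist p00 p01 < S -> mdist p01 p11 < S ->
  mdist p00 p10 < S -> mdist p10 p11 < S ->
  crossing m p00 p01 + crossing m p01 p11 =
  crossing m p00 p10 + crossing m p10 p11.
Proof.
move=> d1 d2 d3 d4.
have d5 := le_lt_trans (metric_triangle p00 p01 p11) (ltrD d1 d2).
have d6 : mdist p01 p10 < S + S.
  apply: le_lt_trans (metric_triangle p01 p00 p10) _.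
  by rewrite (metric_sym p01); exact: ltrD.
have vanish r : ~~ nside r -> mdist r p00 < S + S -> mdist r p01 < S + S ->
    mdist r p10 < S + S ->
    crossing m p00 p01 + crossing m p01 p11 =
    crossing m p00 p10 + crossing m p10 p11.
  by move=> nr r00 r01 r10; rewrite !(crossing_eq0 nr).
have weak p p' : mdist p p' < S -> mdist p p' < S + S.
  by move=> pp'; have := mdist_ge0 p p'; lra.
have self p : mdist p p < S + S.
  by rewrite mdistxx; have := mdist_ge0 p00 p01; lra.
have sym p p' : mdist p p' < S + S -> mdist p' p < S + S by rewrite metric_sym.
have [s00|nr] := boolP (nside p00); last first.
  by apply: (vanish _ nr) => //; exact: weak.
have [s01|nr] := boolP (nside p01); last first.
  by apply: (vanish _ nr) => //; exact/sym/weak.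
have [s10|nr] := boolP (nside p10); last first.
  by apply: (vanish _ nr) => //; [exact/sym/weak|exact: sym].
have [s11|nr] := boolP (nside p11); last first.
  by apply: (vanish _ nr); [exact: sym|exact/sym/weak|exact/sym/weak].
by rewrite /crossing s00 s01 s10 s11/=; lra.
Qed.

End square.

Lemma ray_not_homotopic : ~ coarse_homotopic (ray true) (ray false).
Proof.
move=> [q [H [[cq _] [cH pH] H0 H1]]].
(* Consecutive integers are at distance 1, so [q] varies by less than [s] between them, and [s + 2]
   exceeds every cylinder distance between grid neighbours. *)
have [s s0 qs] := cq 2 ltac:(by []).
have s2 : 0 < s + 2 by rewrite addr_gt0.
have [S S_gt0 HS] := cH _ s2.
(* Over parameter 0 the cylinder has height [q 0], so [S0] bounds how far [H] moves there from its
   start. *)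
have q01 : 0 < \val (q (half 0)) + 1 :> R.
  by have := half_line_ge0 (q (half 0)); lra.
have [S0 S0_gt0 HS0] := cH _ q01.
(* Heights are cut off at [q x], so the grid stays in the cylinder and high rows lie on its top. *)
have cylP (x : half_line R) (j : nat) :
    (x, half (Num.min j%:R (\val (q x)))) \in coarse_cylinder q.
  apply/mem_set; rewrite /coarse_cylinder/= ger0_norm ?ge_min ?lexx ?orbT//.
  by rewrite le_min ler0n half_line_ge0.
pose cyl x j : coarse_cylinder q := SigSub (cylP x j).
have cyl2 x j : \val (\val (cyl x j)).2 = Num.min j%:R (\val (q x)) :> R.
  by rewrite /= ger0_norm// le_min ler0n half_line_ge0.
have cyl_dist x x' j j' : mdist (cyl x j) (cyl x' j') <=
    Num.max (mdist x x') (`|j'%:R - j%:R| + mdist (q x) (q x')).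
  rewrite mdist_subE mdist_prodE [X in Num.max _ X]mdist_halfE !cyl2.
  rewrite ge_max !le_max lexx/=.
  apply/orP; right; rewrite mdist_halfE ler_norml.
  have := ler_norm (j'%:R - j%:R : R); have := ler_norm (j%:R - j'%:R : R).
  have := ler_norm (\val (q x') - \val (q x) : R).
  have := ler_norm (\val (q x) - \val (q x') : R).
  rewrite (distrC (j%:R : R)) (distrC (\val (q x) : R)).
  have [] := leP (j%:R : R) (\val (q x));
  have [] := leP (j'%:R : R) (\val (q x'));
  by move=> *; apply/andP; split; lra.
pose h (i j : nat) : X := H (cyl (half i%:R) j).
(* [3 * S] serves [crossing_square], [S0] keeps column 0 before [m], and 1 prevents a unit step
   starting at a node from crossing [m]. *)
have [m Sm mS] := node_gap (3 * S + S0 + 1).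
have m3S z : node R z -> 3 * S <= `|z - m| by move=> /mS; lra.
have h0 i : h i 0%N = ray true (half i%:R).
  by apply: H0; rewrite cyl2; apply/min_idPl; exact: half_line_ge0.
have h1 i j : \val (q (half i%:R)) <= j%:R :> R ->
    h i j = ray false (half i%:R).
  by move=> qj; apply: H1; apply: val_inj; rewrite cyl2; exact/min_idPr.
have dist_v i j : mdist (h i j) (h i j.+1) < S.
  apply: HS; apply: le_lt_trans (cyl_dist _ _ _ _) _.
  rewrite !mdistxx addr0 -natrB// subSnn normr1 gt_max.
  by apply/andP; split; lra.
have dist_h i j : mdist (h i j) (h i.+1 j) < S.
  apply: HS; apply: le_lt_trans (cyl_dist _ _ _ _) _.
  have d1 : mdist (half (i%:R : R)) (half i.+1%:R) = 1.
    by rewrite mdist_halfE/= !normr_nat -natrB// subSnn normr1.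
  rewrite d1 subrr normr0 add0r gt_max; apply/andP; split; first lra.
  by apply: lt_le_trans (qs _ _ _) _; rewrite ?d1; lra.
have left_small j : npos (h 0%N j) < m.
  have : mdist (h 0%N 0%N) (h 0%N j) < S0.
    apply: HS0; rewrite mdist_subE mdist_prodE mdistxx.
    rewrite [X in Num.max _ X]mdist_halfE !cyl2.
    have := half_line_ge0 (q (half 0)) => /= q0.
    rewrite gt_max q01/= (min_idPl q0) subr0 ger0_norm ?le_min ?ler0n//.
    by rewrite gt_min; apply/orP; right; rewrite ltrDl.
  rewrite h0 => /(le_lt_trans (npos_ndist _ _)).
  by rewrite npos_bead/= !normr0 sub0r normrN ger0_norm ?npos_ge0//; lra.
have [r Hr] := pH [set p : X | npos p <= m]
  ltac:(by apply/mbounded_necklaceP; exists m).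
(* [I > r] puts column [I] outside the preimage of positions up to [m], which has diameter at most
   [r] and meets column 0; [I > m] makes the bottom row cross [m]. *)
pose I := (Num.trunc (`|r| + m)).+1.
have rI : `|r| + m < I%:R by exact: truncnS_gt.
have right_big j : m < npos (h I j).
  rewrite ltNge; apply/negP => hm.
  have := Hr (cyl (half 0) 0%N) (cyl (half I%:R) j) (ltW (left_small 0%N)) hm.
  rewrite mdist_subE mdist_prodE ge_max mdist_halfE/= normr0 subr0 !normr_nat.
  by move=> /andP[Ir _]; have := ler_norm r; lra.
(* At this height every column up to [I] has reached the [false] ray. *)
pose J := (\max_(i < I.+1) (Num.trunc (\val (q (half i%:R)) : R)).+1)%N.
have qJ i : (i <= I)%N -> \val (q (half i%:R)) <= J%:R :> R.
  move=> iI; apply: le_trans (ltW (truncnS_gt _)) _; rewrite ler_nat.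
  exact: (leq_bigmax (Ordinal (iI : (i < I.+1)%N))).
have := @grid_boundary R (fun i j => crossing m (h i j) (h i j.+1))
  (fun i j => crossing m (h i j) (h i.+1 j)) _ I J.
have sq i j :
    crossing m (h i j) (h i j.+1) + crossing m (h i j.+1) (h i.+1 j.+1) =
    crossing m (h i j) (h i.+1 j) + crossing m (h i.+1 j) (h i.+1 j.+1).
  exact: (crossing_square m3S).
move=> /(_ sq).
rewrite big1 => [|j _]; last first.
  by rewrite /crossing !leNgt !left_small subrr if_same.
rewrite big1 => [|i _]; last first.
  rewrite (h1 i J (qJ _ (ltnW (ltn_ord i)))) (h1 _ J (qJ _ (ltn_ord i))).
  rewrite /crossing /ray !nside_bead !npos_bead/= !normr_nat.
  (* A bead labelled [false] has side [true] only at a node, and nodes are more than 1 away from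
     [m]. *)
  case: ifP => // /andP[/set_mem/mS im _].
  have : (i.+1%:R : R) = i%:R + 1 by rewrite -natr1.
  move=> ->; have [mi|im'] := leP m (i%:R : R).
    by rewrite (le_trans mi) ?lerDl// subrr.
  move: im; rewrite ltr0_norm ?subr_lt0// => im.
  have i1m : i%:R + 1 < m by lra.
  by rewrite leNgt i1m subrr.
rewrite [X in _ = _ + X]big1 => [|j _]; last first.
  by rewrite /crossing !(ltW (right_big _)) subrr if_same.
under eq_bigr do rewrite !h0 /crossing !nside_bead !npos_bead/= !normr_nat.
rewrite !addr0.
(* The bottom row telescopes to 1, while the other three sides of the grid vanish. *)
rewrite -(big_mkord xpredT
  (fun i => (m <= i.+1%:R :> R)%R%:R - (m <= i%:R)%R%:R)).
rewrite telescope_sumr//.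
have mI : m <= I%:R by have := normr_ge0 r; lra.
have m0 : (m <= 0%:R) = false by apply/negbTE; rewrite -ltNge; lra.
by rewrite mI m0 subr0 => /eqP; rewrite eq_sym oner_eq0.
Qed.

End necklace_rays.

Theorem theorem7p7 (R : realType) :
  exists X : metricType R,
    [/\ proper_space X, geodesic_space X & card_lt (Ends X) (coarse_pi0 X)].
Proof.
exists (necklace R); split.
- exact: necklace_proper.
- exact: necklace_geodesic.
pose c b := coarse_map `&` coarse_homotopic (@ray R b).
have cpi0 b : coarse_pi0 (necklace R) (c b).
  by exists (ray b) => //; exact: ray_coarse.
apply/andP; split.
  apply: card_le_trans (subset_card_le (@Ends_necklace R)) _.
  apply: card_le_trans (_ : [set c true] #<= _); last first.
    by apply: subset_card_le => _ ->.
  by rewrite (card_le_eql card_set1) (card_le_eqr card_set1).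
(* An injection [f] of the coarse classes into the ends would identify [c true] and [c false], since
   both go to the only possible end. *)
apply/negP => /pcard_leP[f].
have fE b : f (c b) = proper_ray (necklace R).
  exact: (@Ends_necklace R _ (@funS _ _ _ _ f _ (cpi0 b))).
have cc : c true = c false.
  apply: (@inj _ _ _ f); last exact: etrans (fE true) (esym (fE false)).
    exact/mem_set/cpi0.
  exact/mem_set/cpi0.
have : c false (ray false).
  by split; [exact: ray_coarse|exact/coarse_homotopic_refl/ray_coarse].
by rewrite -cc => -[_]; exact: ray_not_homotopic.
Qed.
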